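(* Let $K\ge1$ and let $r:[0,1]^K\to\mathbb{R}$ be a monotone smooth index invariant reward function. Then for any $\boldsymbol{\mu}\in[0,1]^K$, $$\max_{I\subsetneq[K]}\frac{\gamma_{g,1}^2(\boldsymbol{\mu};I)}{K_I}\;\ge\;\frac{\gamma_{g,2}^2(\boldsymbol{\mu};\emptyset)}{1+\ln K}.$$ Furthermore, if $\mu_{\min}=\min_{i:\mu_i>0}\mu_i$ and $\mu_{\max}=\max_{i:\mu_i<1}\mu_i$ (assuming both index sets are nonempty), then $$\max_{I\subsetneq[K]}\frac{\tilde\gamma_g^2(\boldsymbol{\mu};I)}{K_I}\;\ge\;\frac{\gamma_{g,2}^2(\boldsymbol{\mu};\emptyset)}{(1+\ln K)\left(3+\ln\frac{1}{\mu_{\min}}+\ln\frac{1}{1-\mu_{\max}}\right)}.$$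
   Context: A smooth index invariant reward function is (identified with) a differentiable function $r:[0,1]^K\to\mathbb{R}$ of the means of the $K$ arms in an action that does not depend on their order (symmetric in its $K$ arguments). It is monotone if $\nabla_i r(\boldsymbol\mu)\ge0$ for all $\boldsymbol\mu\in[0,1]^K$ and all $i\in[K]$, where $[K]=\{1,\dots,K\}$. For $I\subset[K]$ let $K_I=K-|I|$, and let $p=p^{\boldsymbol\mu,I}\in[0,1]^K$ be the vector whose first $K_I$ entries are the $\mu_i$, $i\notin I$, sorted in nondecreasing order, followed by the entries $\mu_i$, $i\in I$. Define $$\gamma_{g,2}^2(\boldsymbol\mu;I)=\sum_{i\notin I}\mu_i(1-\mu_i)\big(\nabla_i r(\boldsymbol\mu)\big)^2,\qquad \gamma_{g,1}^2(\boldsymbol\mu;I)=\Big(\sum_{i\notin I}\sqrt{\mu_i(1-\mu_i)}\,\nabla_i r(\boldsymbol\mu)\Big)^2,$$ $$\tilde\gamma_g^2(\boldsymbol\mu;I)=\sum_{i=1}^{K_I}p_i(1-p_i)\big(\nabla_i r(p)\big)^2+2\sum_{i=1}^{K_I}\sum_{j=i+1}^{K_I}p_i(1-p_j)\nabla_i r(p)\nabla_j r(p).$$ *)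

(* Defs.v *)
From mathcomp Require Import all_boot all_order all_algebra perm.
From mathcomp Require Import all_classical all_reals all_analysis.

Set Implicit Arguments.
Unset Strict Implicit.
Unset Printing Implicit Defensive.

Import Order.TTheory GRing.Theory Num.Theory.
Import numFieldNormedType.Exports.

Local Open Scope classical_set_scope.
Local Open Scope ring_scope.

Section RewardFunctions.
Context {R : realType} {K : nat}.
Implicit Types (r : 'rV[R]_K -> R) (mu : 'rV[R]_K) (I : {set 'I_K}).

Definition unit_cube : set 'rV[R]_K := [set mu | forall i, 0 <= mu 0 i <= 1].

(* A function on the cube is represented by a total function on 'rV_K.  All the
   notions below are relative to the cube (one-sided on its faces), so the
   values outside of the cube are irrelevant. *)
Definition differentiable_on_cube r : Prop :=
  forall mu, unit_cube mu ->
  let F := within unit_cube (nbhs mu) in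
  exists g : 'rV[R]_K,
    (fun nu : 'rV[R]_K =>
       r nu - r mu - \sum_(i < K) g 0 i * (nu 0 i - mu 0 i))
    =o_F (fun nu : 'rV[R]_K => nu - mu).

(* The library's derivative along the i-th basis vector, with increments
   restricted to those that stay in the cube. *)
Definition grad r mu (i : 'I_K) : R :=
  lim ((fun h : R => h^-1 * (r (mu + h *: delta_mx 0 i) - r mu)) @
       within [set h : R | unit_cube (mu + h *: delta_mx 0 i)] 0^').

Definition symmetric_on_cube r : Prop :=
  forall (s : 'S_K) mu, unit_cube mu -> r (col_perm s mu) = r mu.

Definition smooth_index_invariant r : Prop :=
  differentiable_on_cube r /\ symmetric_on_cube r.

Definition monotone_reward r : Prop :=
  forall mu, unit_cube mu -> forall i, 0 <= grad r mu i.

Definition cardK I : nat := (K - #|I|)%N.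

Definition pvec mu I : 'rV[R]_K :=
  \row_k nth 0 (sort <=%R [seq mu 0 i | i <- enum (~: I)]
                ++ [seq mu 0 i | i <- enum I]) k.

Definition gamma2_sq r mu I : R :=
  \sum_(i | i \notin I) mu 0 i * (1 - mu 0 i) * grad r mu i ^+ 2.

Definition gamma1_sq r mu I : R :=
  (\sum_(i | i \notin I) Num.sqrt (mu 0 i * (1 - mu 0 i)) * grad r mu i) ^+ 2.

Definition gamma_tilde_sq r mu I : R :=
  let p := pvec mu I in
  \sum_(i < K | (i < cardK I)%N) p 0 i * (1 - p 0 i) * grad r p i ^+ 2
  + 2 * \sum_(i < K | (i < cardK I)%N) \sum_(j < K | (i < j < cardK I)%N)
          p 0 i * (1 - p 0 j) * grad r p i * grad r p j.

(* Maximum over the proper subsets of 'I_K.  The initial value is that of the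
   empty set, which is itself a proper subset when 0 < K. *)
Definition max_proper (F : {set 'I_K} -> R) : R :=
  \big[Num.max/F finset.set0]_(I : {set 'I_K} | I \proper [set: 'I_K]%SET) F I.

(* The initial values 1 and 0 have no effect on the extrema below when the
   index set is nonempty and mu is in the cube. *)
Definition mu_min mu : R := \big[Num.min/1]_(i < K | 0 < mu 0 i) mu 0 i.
Definition mu_max mu : R := \big[Num.max/0]_(i < K | mu 0 i < 1) mu 0 i.

End RewardFunctions.

(* Main.v *)
Require Import Defs.
From mathcomp Require Import all_boot all_order all_algebra perm.
From mathcomp Require Import all_classical all_reals all_analysis.
From mathcomp Require Import ring lra.

Import Order.TTheory GRing.Theory Num.Theory.
Import numFieldNormedType.Exports.
Local Open Scope ring_scope.

(** Put [x_i = sqrt (mu_i (1 - mu_i)) * grad_i].  If [M] bounds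
    [(sum_S x)^2 / |S|] for every nonempty [S], the smallest [x_i] on [S]
    satisfies [x_i^2 <= M / |S|]; removing it and iterating gives
    [sum x^2 <= M (1 + 1/2 + ... + 1/K) <= M (1 + ln K)].

    For the second inequality, [gamma_tilde] is compared with [gamma_1] for each
    [I] separately.  With [w = sqrt ((1 - p) / p)], one has for [p_i <= p_j]
    [p_i (1 - p_j) grad_i grad_j = x_i x_j (w_j / w_i)], so [gamma_tilde] is a
    quadratic form in [x] whose kernel is [exp (- |t_i - t_j|)] for
    [t = - ln w].  Such a Markovian kernel is, up to the factor
    [1 + (length of the t-range)], at least the constant kernel; here the length
    is at most [ln (1 / mu_min) + ln (1 / (1 - mu_max))]. *)

(** * Permuting the arms: equivariance of the gradient *)

Lemma unit_cube_col_perm (R : realType) (K : nat) (s : 'S_K) (mu : 'rV[R]_K) :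
  unit_cube (col_perm s mu) <-> unit_cube mu.
Proof.
split=> h i; last by rewrite mxE.
by have := h ((s^-1)%g i); rewrite mxE permKV.
Qed.

Lemma col_perm_shift (R : realType) (K : nat) (s : 'S_K) (mu : 'rV[R]_K) h i :
  col_perm s mu + h *: delta_mx 0 i = col_perm s (mu + h *: delta_mx 0 (s i)).
Proof. by apply/rowP => j; rewrite !mxE (inj_eq perm_inj). Qed.

(** Moving along [delta_mx 0 i] after permuting is the same as moving along [delta_mx 0 (s i)] and
    then permuting. Hence both limits have the same admissible increments and, by symmetry, the same
    quotients. *)
Lemma grad_col_perm (R : realType) (K : nat) (r : 'rV[R]_K -> R) (s : 'S_K)
    (mu : 'rV[R]_K) (i : 'I_K) :
  symmetric_on_cube r -> unit_cube mu ->
  grad r (col_perm s mu) i = grad r mu (s i).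
Proof.
move=> r_sym mu_cube; rewrite /grad; congr lim.
apply/seteqP; split=> A /=; rewrite /nbhs/= /within/=; apply: filterS => h /=;
  rewrite col_perm_shift unit_cube_col_perm => hA D; move: (hA D);
  by rewrite !r_sym.
Qed.

(** * Bounds on the maximum over proper subsets *)

Section MaxProper.
Context {R : realType} {K : nat}.
Implicit Types (F G : {set 'I_K} -> R) (I : {set 'I_K}).

Lemma max_proper_ge F I : I \proper [set: 'I_K]%SET -> F I <= max_proper F.
Proof. by move=> pI; rewrite /max_proper; apply: le_bigmax_cond. Qed.

(** The initial value [F finset.set0] has to be bounded as well; [0 < K] makes the empty set
    proper. *)
Lemma max_proper_le F M : (0 < K)%N ->
  (forall I, I \proper [set: 'I_K]%SET -> F I <= M) -> max_proper F <= M.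
Proof.
move=> K0 FM; apply/bigmax_leP; split=> // ; apply: FM.
by rewrite properT; apply/eqP => /(congr1 (fun A : {set 'I_K} => #|A|));
  rewrite cards0 cardsT card_ord => K00; rewrite -K00 in K0.
Qed.

End MaxProper.

(** * From bounds on all partial sums to a bound on the sum of squares *)

Lemma ln_le_subr1 (R : realType) (x : R) : 0 < x -> ln x <= x - 1.
Proof. by move=> x0; have := @le_ln1Dx R (x - 1); rewrite addrCA subrr addr0; apply; lra. Qed.

Lemma sum_sqr_le_harmonic (R : realType) (T : finType) (x : T -> R) (M : R)
    (x_ge0 : forall i, 0 <= x i)
    (xM : forall S : {set T}, S != finset.set0 ->
       (\sum_(i in S) x i) ^+ 2 / #|S|%:R <= M) (S : {set T}) :
  S != finset.set0 -> \sum_(i in S) x i ^+ 2 <= M * (1 + ln #|S|%:R).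
Proof.
move: {2}#|S| (erefl #|S|) => n; elim: n S => [|n IH] S cS S0.
  by rewrite -cards_eq0 cS in S0.
have [i0 i0S] := set0Pn _ S0.
have [i iS imin] : exists2 i, i \in S & forall j, j \in S -> x i <= x j.
  by case: (@arg_minP _ _ _ i0 (mem S) x i0S) => i iS h; exists i.
have n0 : 0 < n.+1%:R :> R by rewrite ltr0n.
have xiM : x i ^+ 2 <= M / n.+1%:R.
  rewrite ler_pdivlMr //; apply: le_trans (xM S S0).
  rewrite cS ler_pdivlMr // -mulrA -expr2 -exprMn ler_sqr ?nnegrE.
  - by rewrite mulr_natr -cS -sumr_const; apply: ler_sum => j /imin.
  - by rewrite mulr_ge0.
  - exact: sumr_ge0.
rewrite (big_setD1 i) //= cS.
have cS1 : #|S :\ i| = n by move: cS; rewrite (cardsD1 i) iS => -[].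
(* A singleton is treated apart, since the induction hypothesis needs a nonempty set. *)
case: n => [|n] in IH cS n0 xiM cS1 *.
  move/eqP: cS1; rewrite cards_eq0 => /eqP ->.
  by rewrite big_set0 ln1 addr0 addr0 mulr1 -[leRHS]divr1.
have {}IH : \sum_(j in S :\ i) x j ^+ 2 <= M * (1 + ln n.+1%:R).
  by rewrite -[in leRHS]cS1; apply: IH => //; rewrite -cards_eq0 cS1.
apply: (le_trans (lerD xiM IH)).
have M0 : 0 <= M.
  by apply: le_trans (xM S S0); rewrite divr_ge0 // sqr_ge0.
rewrite -mulrDr ler_wpM2l //.
have n1 : 0 < n.+1%:R :> R by rewrite ltr0n.
(* The removed element costs [M / n.+2], and the logarithm grows by at least [1 / n.+2]. *)
have : ln (n.+1%:R / n.+2%:R) <= n.+1%:R / n.+2%:R - 1 :> R.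
  by apply: ln_le_subr1; rewrite divr_gt0.
rewrite ln_div ?posrE //.
have -> : n.+1%:R / n.+2%:R - 1 = - n.+2%:R^-1 :> R.
  by move: n1; rewrite -[n.+2%:R]natr1; set u := n.+1%:R => u0; field; rewrite gt_eqF //; lra.
move: (ln n.+1%:R) (ln n.+2%:R) (n.+2%:R^-1) => x1 x2 x3; lra.
Qed.

(** * Reindexing of sums *)

(** [gamma_tilde_sq] groups pairs by the smaller index; grouping by the larger one lets the sum grow
    by one block per added point, as [quadS] requires. *)
Lemma exchange_triangular (R : realType) (K n : nat) (F : nat -> nat -> R) :
  (n <= K)%N ->
  \sum_(i < K | (i < n)%N) \sum_(j < K | (i < j < n)%N) F i j
  = \sum_(j < n) \sum_(i < j) F i j.
Proof.
move=> nK; rewrite (exchange_big_dep (fun j : 'I_K => (j < n)%N)) /=; last first.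
  by move=> i j _ /andP[].
rewrite (big_ord_widen K (fun j => \sum_(i < j) F i j)) //.
apply: eq_bigr => j jn; rewrite (big_ord_widen K (F^~ j)); last exact: ltnW.
apply: eq_bigl => i; rewrite jn andbT.
by case: (ltnP i j) => ij; rewrite ?andbF // andbT (ltn_trans ij jn).
Qed.

Lemma big_seq_nth_map (R : realType) (T : Type) (e : seq T) (f h : T -> R)
    (F : R -> R -> R) :
  \sum_(i <- e) F (f i) (h i)
  = \sum_(k < size e) F (nth 0 (map f e) k) (nth 0 (map h e) k).
Proof.
elim: e => [|i e IH]; first by rewrite big_nil big_ord0.
by rewrite big_cons big_ord_recl /= IH.
Qed.

(** * The quadratic form of a sorted sequence of means *)

Section SortedBernoulli.
Context {R : realType}.
Implicit Types (a g : nat -> R) (b c A B : R).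

Definition wt b : R := Num.sqrt ((1 - b) / b).

Lemma wt_gt0 b : 0 < b < 1 -> 0 < wt b.
Proof. by case/andP=> b0 b1; rewrite sqrtr_gt0 divr_gt0 // subr_gt0. Qed.

Lemma wt_sqr b : 0 < b < 1 -> wt b ^+ 2 = (1 - b) / b.
Proof.
by case/andP=> b0 b1; rewrite sqr_sqrtr // divr_ge0 ?subr_ge0 // ltW.
Qed.

Lemma wt_le b c : 0 < b -> b <= c -> c < 1 -> wt c <= wt b.
Proof.
move=> b0 bc c1; have c0 : 0 < c by lra.
by rewrite ler_wsqrtr // ler_pdivrMr // mulrAC ler_pdivlMr //; nra.
Qed.

Lemma mul_wt b : 0 < b < 1 -> b * wt b = Num.sqrt (b * (1 - b)).
Proof.
case/andP=> b0 b1; rewrite -{1}[b]gtr0_norm // -sqrtr_sqr -sqrtrM ?sqr_ge0 //.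
by congr Num.sqrt; field; rewrite gt_eqF.
Qed.

(* One step of the Markov chain: this is [((u + v) H - c)^2 >= 0] combined with
   [(u - v) / (u + v) <= 1 - v / u <= ln u - ln v]. *)
Lemma potential_drop (u v H c : R) : 0 < v -> v <= u ->
  2 * c * H * (u - v) - c ^+ 2 * (ln u - ln v) <= H ^+ 2 * (u ^+ 2 - v ^+ 2).
Proof.
move=> v0 vu; have u0 : 0 < u by lra.
have uv0 : 0 < u + v by lra.
have : ln (v / u) <= v / u - 1 by apply: ln_le_subr1; rewrite divr_gt0.
rewrite ln_div ?posrE // => lnvu.
have le1 : (u - v) / (u + v) <= ln u - ln v.
  apply: (@le_trans _ _ (1 - v / u)); last lra.
  have -> : 1 - v / u = (u - v) / u by field; rewrite gt_eqF.
  rewrite ler_wpM2l ?subr_ge0 // lef_pV2 ?posrE //; lra.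
have := ler_wpM2l (sqr_ge0 c) le1.
have : 0 <= (u - v) / (u + v) * ((u + v) * H - c) ^+ 2.
  by rewrite mulr_ge0 ?sqr_ge0 // divr_ge0 ?subr_ge0 // ltW.
have -> : (u - v) / (u + v) * ((u + v) * H - c) ^+ 2 =
  H ^+ 2 * (u ^+ 2 - v ^+ 2) - 2 * c * H * (u - v) + c ^+ 2 * ((u - v) / (u + v)).
  by field; rewrite gt_eqF.
lra.
Qed.

(** For means strictly between 0 and 1, [a i * g i] is [x_i / wt (a i)], so [lin a g n * wt b] is
    the kernel applied to [x] at a further point [b] to the right. *)
Definition lin a g n : R := \sum_(i < n) a i * g i.
Definition std a g n : R := \sum_(i < n) Num.sqrt (a i * (1 - a i)) * g i.
Definition quad a g n : R :=
  \sum_(i < n) a i * (1 - a i) * g i ^+ 2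
  + 2 * \sum_(j < n) \sum_(i < j) a i * (1 - a j) * g i * g j.

Lemma quadS a g n : quad a g n.+1 =
  quad a g n + a n * (1 - a n) * g n ^+ 2 + 2 * (1 - a n) * g n * lin a g n.
Proof.
rewrite /quad !big_ord_recr /= /lin.
have -> : \sum_(i < n) a i * (1 - a n) * g i * g n =
          (\sum_(i < n) a i * g i) * ((1 - a n) * g n).
  by rewrite mulr_suml; apply: eq_bigr => i _; ring.
ring.
Qed.

(* The inequality is stated at an arbitrary [b] above the first [n] points
   because the defect only depends on [b] through [potential_drop], while adding
   a point at [b] itself changes both sides equally.  Points with [g i = 0] are
   exempt, which lets degenerate means 0 and 1 be discarded. *)
Lemma quad_invariant a g A B c n : 0 < A -> B < 1 ->
  (forall i, (i < n)%N -> g i != 0 -> A <= a i <= B) ->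
  (forall i j, (i < j < n)%N -> a i <= a j) ->
  forall b, A <= b <= B -> (forall i, (i < n)%N -> g i != 0 -> a i <= b) ->
  2 * c * (std a g n - lin a g n * wt b) - c ^+ 2 * (ln (wt A) - ln (wt b))
    <= quad a g n - lin a g n ^+ 2 * wt b ^+ 2.
Proof.
move=> A0 B1; elim: n => [|n IH] aAB a_le b /andP[Ab bB] a_b.
  rewrite /quad /lin /std !big_ord0.
  have := @potential_drop (wt A) (wt b) 0 c (@wt_gt0 b _) (@wt_le A b A0 Ab _).
  by move=> /(_ ltac:(lra) ltac:(lra)); lra.
have {}IH := IH (fun i ni => aAB i (ltnW ni))
  (fun i j ij => a_le i j ltac:(by case/andP: ij => -> /ltnW)).
have [gn0|gn0] := eqVneq (g n) 0.
  rewrite quadS /std /lin !big_ord_recr /= gn0 expr0n /= !(mulr0, mul0r, addr0).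
  by apply: IH => [|i ni]; [apply/andP | exact: a_b (ltnW ni)].
have /andP[Aa aB] := aAB n (ltnSn n) gn0.
have ab := a_b n (ltnSn n) gn0.
(* The bound is taken at [a n] and then transported to [b]: [potential_drop], with [lin] already
   including the new point, pays for lowering the weight from [wt (a n)] to [wt b]. *)
have := IH (a n) ltac:(by apply/andP).
move=> /(_ (fun i ni _ => a_le i n ltac:(by rewrite ni /=))).
have := @potential_drop (wt (a n)) (wt b) (lin a g n.+1) c
  (@wt_gt0 b ltac:(lra)) (@wt_le (a n) b ltac:(lra) ab ltac:(lra)).
rewrite quadS /std /lin !big_ord_recr /= -mul_wt; last lra.
rewrite -/(lin a g n) -/(std a g n).
have a0 : a n != 0 by rewrite gt_eqF; lra.
have := @wt_sqr (a n) ltac:(lra).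
set w := wt (a n); set v := wt b; set H := lin a g n => wE P1 P2.
have E : (H + a n * g n) ^+ 2 * w ^+ 2 =
  H ^+ 2 * w ^+ 2 + a n * (1 - a n) * g n ^+ 2 + 2 * (1 - a n) * g n * H.
  by rewrite wE; field.
lra.
Qed.

(** [quad_invariant] is used at the right end [b = B], where it accounts for the whole range of
    [ln wt]. *)
Lemma std_sqr_le_quad a g A B n : 0 < A <= 1 -> 0 <= B < 1 ->
  (forall i, (i < n)%N -> 0 <= a i <= 1) -> (forall i, (i < n)%N -> 0 <= g i) ->
  (forall i, (i < n)%N -> 0 < a i -> A <= a i) ->
  (forall i, (i < n)%N -> a i < 1 -> a i <= B) ->
  (forall i j, (i < j < n)%N -> a i <= a j) ->
  std a g n ^+ 2 <= (3 + ln (1 / A) + ln (1 / (1 - B))) * quad a g n.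
Proof.
move=> /andP[A0 A1] /andP[B0 B1] a01 g0 aA aB a_le.
have lnA0 : 0 <= ln (1 / A) by rewrite ln_ge0 // ler_pdivlMr // mul1r.
have lnB0 : 0 <= ln (1 / (1 - B)) by rewrite ln_ge0 // ler_pdivlMr; lra.
set L := 3 + _ + _.
have L0 : 0 < L by rewrite /L; lra.
(* Means equal to 0 or 1 have infinite [t]; they do not contribute to [std]. *)
pose h i := if 0 < a i < 1 then g i else 0.
have stdE : std a h n = std a g n.
  apply: eq_bigr => i _; rewrite /h; case: ifPn => // ai.
  have /andP[] := a01 i (ltn_ord i).
  rewrite le_eqVlt => /orP[/eqP <-|i0]; first by rewrite mul0r sqrtr0 !mul0r.
  rewrite le_eqVlt => /orP[/eqP ->|i1]; first by rewrite subrr !mulr0 sqrtr0 mul0r.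
  by rewrite i0 i1 in ai.
have h0 i : (i < n)%N -> 0 <= h i by rewrite /h; case: ifP => // _; exact: g0.
have hg i : (i < n)%N -> h i <= g i by rewrite /h; case: ifP => // _; exact: g0.
(* All coefficients of [quad] are nonnegative, so shrinking nonnegative gradients can only lower
   it. *)
have quad_le : quad a h n <= quad a g n.
  rewrite /quad lerD // ?ler_pM2l //.
  - apply: ler_sum => i _; have /andP[? ?] := a01 i (ltn_ord i).
    rewrite ler_wpM2l ?mulr_ge0 ?subr_ge0 // lerXn2r ?nnegrE ?g0 ?h0 ?hg //.
  - apply: ler_sum => j _; apply: ler_sum => i _.
    have jn := ltn_ord j; have ni : (i < n)%N := ltn_trans (ltn_ord i) jn.
    have /andP[? ?] := a01 i ni; have /andP[? ?] := a01 j jn.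
    by rewrite -!mulrA !ler_wpM2l ?subr_ge0 // ler_pM ?h0 ?hg.
rewrite -stdE; apply: le_trans (ler_wpM2l (ltW L0) quad_le).
have hAB i : (i < n)%N -> h i != 0 -> A <= a i <= B.
  rewrite /h => ni; case: ifP; last by rewrite eqxx.
  by case/andP => ai0 ai1 _; rewrite aA ?aB.
(* If [B < A], no mean lies strictly between 0 and 1 unless its gradient vanishes, so both sides are
   0. *)
have [AB|BA] := leP A B; last first.
  suff hz i : (i < n)%N -> h i = 0.
    have -> : std a h n = 0 by apply: big1 => i _; rewrite hz ?mulr0.
    have -> : quad a h n = 0.
      rewrite /quad !big1 ?mulr0 ?addr0 // => i _; last first.
        by rewrite hz // expr0n /= mulr0.
      by apply: big1 => j _; rewrite (hz i) // mulr0.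
    by rewrite mulr0 expr0n.
  move=> ni; apply/eqP; case: eqP => // /eqP /(hAB i ni) /andP[? ?]; lra.
(* Completing the square linearizes the target; [c] is optimized below. *)
have key c : 2 * c * std a h n - c ^+ 2 * L <= quad a h n.
  have := @quad_invariant a h A B c n A0 B1 hAB a_le B.
  rewrite AB lexx => /(_ isT (fun i ni hi => proj2 (andP (hAB i ni hi)))).
  have lnw b : 0 < b < 1 -> 2 * ln (wt b) = ln (1 - b) - ln b.
    move=> b01; rewrite -ln_div ?posrE -?wt_sqr //; try lra.
    by rewrite lnXn ?wt_gt0 // mulr2n; lra.
  have lnA1 : ln (1 - A) <= 0 by rewrite ln_le0; lra.
  have lnB1 : ln B <= 0 by rewrite ln_le0; lra.
  (* [ln wt] is half a log-odds; dropping the nonpositive [ln (1 - A)] and [ln B] makes its range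
     fit in [L - 1]. The remaining 1 is spent on the square [(lin a h n * wt B - c) ^+ 2]. *)
  have D : ln (wt A) - ln (wt B) <= L - 1.
    move: (lnw A ltac:(lra)) (lnw B ltac:(lra)) lnA0 lnB0.
    by rewrite /L !div1r !lnV ?posrE; lra.
  have := ler_wpM2l (sqr_ge0 c) D.
  have := sqr_ge0 (lin a h n * wt B - c); lra.
(* This [c] maximizes the left side of [key], with value [std a h n ^+ 2 / L]. *)
have := key (std a h n / L).
rewrite -ler_pdivrMl //; apply: le_trans.
by rewrite le_eqVlt; apply/orP; left; apply/eqP; field; rewrite gt_eqF.
Qed.

End SortedBernoulli.

(** * Sorting the arms, and the two inequalities for rewards *)

(** The vector [pvec mu I] is a column permutation of [mu], so by symmetry its gradient is the
    permuted gradient of [mu]. Both quantities then involve the same two sequences. *)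
Lemma gamma1_sq_le_gamma_tilde_sq (R : realType) (K : nat)
    (r : 'rV[R]_K -> R) (mu : 'rV[R]_K) (I : {set 'I_K}) (A B : R) :
  symmetric_on_cube r -> monotone_reward r -> unit_cube mu ->
  0 < A <= 1 -> 0 <= B < 1 ->
  (forall i, 0 < mu 0 i -> A <= mu 0 i) -> (forall i, mu 0 i < 1 -> mu 0 i <= B) ->
  gamma1_sq r mu I <= (3 + ln (1 / A) + ln (1 / (1 - B))) * gamma_tilde_sq r mu I.
Proof.
move=> r_sym r_mono mu_cube A01 B01 muA muB.
(* Indices are sorted rather than means, so that each gradient stays attached to its mean. *)
pose e := sort (relpre (mu 0) <=%R) (enum (~: I)).
pose e' := e ++ enum I.
have e_perm : perm_eq e (enum (~: I)) by rewrite /e perm_sort.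
have size_e : size e = cardK I.
  by rewrite (perm_size e_perm) -cardE cardsCs finset.setCK card_ord.
have size_e' : size e' = K.
  by rewrite size_cat size_e -cardE /cardK subnK // -[leqRHS]card_ord max_card.
have uniq_e' : uniq e'.
  rewrite cat_uniq (perm_uniq e_perm) !enum_uniq andbT /=.
  apply/hasPn => i /=; rewrite mem_enum (perm_mem e_perm) mem_enum inE => ->.
  by [].
(* The default [k] is never returned, as [e'] has length [K]. *)
pose sg (k : 'I_K) := nth k e' k.
have sg_nth (k l : 'I_K) : sg k = nth l e' k.
  by apply: set_nth_default; rewrite size_e'.
have sg_inj : injective sg.
  move=> k l; rewrite (sg_nth k k) (sg_nth l k) => /eqP.
  by rewrite nth_uniq ?size_e' // => /eqP /val_inj.
pose s := perm sg_inj.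
have pE : pvec mu I = col_perm s mu.
  apply/rowP => k; rewrite !mxE permE /sg sort_map -map_cat (nth_map k) //.
  by rewrite size_e'.
have nK : (cardK I <= K)%N by rewrite leq_subr.
pose a i := nth 0 (map (mu 0) e) i.
pose g i := nth 0 (map (grad r mu) e) i.
have sgE (k : 'I_K) : (k < cardK I)%N -> sg k = nth k e k.
  by move=> kn; rewrite /sg nth_cat size_e kn.
have paE (k : 'I_K) : (k < cardK I)%N -> pvec mu I 0 k = a k.
  by move=> kn; rewrite pE mxE permE sgE // /a (nth_map k) ?size_e.
have gE (k : 'I_K) : (k < cardK I)%N -> grad r (pvec mu I) k = g k.
  by move=> kn; rewrite pE grad_col_perm // permE sgE // /g (nth_map k) ?size_e.
have -> : gamma_tilde_sq r mu I = quad a g (cardK I).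
  rewrite /gamma_tilde_sq /quad; congr (_ + 2 * _).
    rewrite (big_ord_widen K (fun i => a i * (1 - a i) * g i ^+ 2)) //.
    by apply: eq_bigr => i iI; rewrite paE // gE.
  rewrite -(@exchange_triangular _ K _ (fun i j => a i * (1 - a j) * g i * g j)) //.
  apply: eq_bigr => i iI; apply: eq_bigr => j /andP[_ jI].
  by rewrite !paE // !gE.
have -> : gamma1_sq r mu I = std a g (cardK I) ^+ 2.
  rewrite /gamma1_sq /std; congr (_ ^+ 2).
  rewrite (eq_bigl (fun i => i \in ~: I)); last by move=> i; rewrite inE.
  rewrite -big_enum -(perm_big _ e_perm) /=.
  rewrite -size_e.
  exact: (big_seq_nth_map _ _ e (mu 0) (grad r mu) (fun x y => Num.sqrt (x * (1 - x)) * y)).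
have memP (P : R -> R -> Prop) : (forall j, P (mu 0 j) (grad r mu j)) ->
    forall i, (i < cardK I)%N -> P (a i) (g i).
  move=> h i iI; have iK := leq_trans iI nK.
  by rewrite /a /g !(nth_map (Ordinal iK)) ?size_e.
apply: std_sqr_le_quad => //.
- by apply: (memP (fun x _ => 0 <= x <= 1)) => j; exact: mu_cube.
- by apply: (memP (fun _ y => 0 <= y)) => j; exact: r_mono.
- exact: (memP (fun x _ => 0 < x -> A <= x)).
- exact: (memP (fun x _ => x < 1 -> x <= B)).
- move=> i j /andP[ij jI]; rewrite /a /e -sort_map.
  apply: sorted_leq_nth (ltnW ij); rewrite ?inE ?size_sort ?size_map.
  + exact: le_trans.
  + exact: lexx.
  + exact/sort_sorted/le_total.
  + by rewrite -(perm_size e_perm) size_e (ltn_trans ij).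
  + by rewrite -(perm_size e_perm) size_e.
Qed.

Theorem proposition4 (R : realType) (K : nat) (K_ge1 : (1 <= K)%N)
    (r : 'rV[R]_K -> R)
    (r_smooth : smooth_index_invariant r) (r_mono : monotone_reward r)
    (mu : 'rV[R]_K) (mu_cube : unit_cube mu) :
  gamma2_sq r mu finset.set0 / (1 + ln K%:R)
    <= max_proper (fun I => gamma1_sq r mu I / (cardK I)%:R)
  /\ ((exists i, 0 < mu 0 i) -> (exists i, mu 0 i < 1) ->
      gamma2_sq r mu finset.set0
        / ((1 + ln K%:R) * (3 + ln (1 / mu_min mu) + ln (1 / (1 - mu_max mu))))
      <= max_proper (fun I => gamma_tilde_sq r mu I / (cardK I)%:R)).
Proof.
have lnK : 0 < 1 + ln K%:R :> R by rewrite ltr_wpDr // ln_ge0 // ler1n.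
have part1 : gamma2_sq r mu finset.set0 / (1 + ln K%:R)
    <= max_proper (fun I => gamma1_sq r mu I / (cardK I)%:R).
  rewrite ler_pdivrMr //.
  pose x i := Num.sqrt (mu 0 i * (1 - mu 0 i)) * grad r mu i.
  have -> : gamma2_sq r mu finset.set0 = \sum_(i in [set: 'I_K]%SET) x i ^+ 2.
    apply: eq_big => [i|i _]; first by rewrite !inE.
    have /andP[? ?] := mu_cube i.
    by rewrite /x exprMn sqr_sqrtr // mulr_ge0 // subr_ge0.
  have -> : K%:R = #|[set: 'I_K]%SET|%:R :> R by rewrite cardsT card_ord.
  apply: sum_sqr_le_harmonic.
  - by move=> i; rewrite mulr_ge0 ?sqrtr_ge0 ?r_mono.
  - move=> S S0.
    (* Nonempty sets [S] are exactly the complements of proper subsets, and [cardK (~: S)] is the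
       size of [S]. *)
    have := @max_proper_ge R K (fun I => gamma1_sq r mu I / (cardK I)%:R) (~: S).
    rewrite properT -finset.setC0 (inj_eq (can_inj (@finset.setCK _))) => /(_ S0).
    have -> : cardK (~: S) = #|S| by rewrite /cardK [RHS]cardsCs card_ord.
    apply: le_trans.
    suff -> : \sum_(i in S) x i = \sum_(i | i \notin ~: S) x i by [].
    by apply: eq_bigl => i; rewrite inE negbK.
  - by rewrite -cards_eq0 cardsT card_ord -lt0n.
split=> // _ _.
have mm0 : 0 < mu_min mu by apply/bigmin_gtP; split.
have mm1 : mu_min mu <= 1 by exact: bigmin_le_id.
have mM0 : 0 <= mu_max mu by exact: bigmax_ge_id.
have mM1 : mu_max mu < 1 by apply/bigmax_ltP; split.
set L := 3 + _ + _.
have L0 : 0 < L.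
  have : 0 <= ln (1 / mu_min mu) by rewrite ln_ge0 // ler_pdivlMr // mul1r.
  have : 0 <= ln (1 / (1 - mu_max mu)) by rewrite ln_ge0 // ler_pdivlMr; lra.
  by rewrite /L; lra.
(* Dividing the first inequality by [L] leaves a comparison of [gamma1_sq] with [L * gamma_tilde_sq]
   for each [I]. *)
rewrite invfM mulrA ler_pdivrMr //; apply: le_trans part1 _.
apply: max_proper_le => // I pI.
have := @max_proper_ge R K (fun I => gamma_tilde_sq r mu I / (cardK I)%:R) I pI.
move=> /(ler_wpM2r (ltW L0)); apply: le_trans.
rewrite [leRHS]mulrAC ler_wpM2r ?invr_ge0 // mulrC.
apply: gamma1_sq_le_gamma_tilde_sq => //; first by case: r_smooth.
- by rewrite mm0.
- by rewrite mM0.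
- by move=> i mui; exact: bigmin_le_cond.
- by move=> i mui; apply: le_bigmax_cond.
Qed.
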